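(* $\mathrm{ILM}\cong\mathrm{ILM}_2$, where in $\mathrm{ILM}_2$ one defines $\neg\alpha:=\alpha\rightarrow\bot$. That is, for every $\mathrm{ILM}$-formula $\alpha$, if $\alpha^{*}$ denotes the $\mathrm{ILM}_2$-formula obtained from $\alpha$ by replacing (recursively) every subformula $\neg\beta$ by $\beta\rightarrow\bot$, then $\vdash_{\mathrm{ILM}}\alpha$ if and only if $\vdash_{\mathrm{ILM}_2}\alpha^{*}$.
   Context: Two logics are equivalent ($\cong$) if they have the same language (here: after introducing $\neg$ into $\mathrm{ILM}_2$ as the stated abbreviation) and the same theorems. Formulas of $\mathrm{ILM}$ are built from propositional variables and constants $\top,\bot$ with $\wedge,\vee,\rightarrow,\neg,\sim$; $\alpha\leftrightarrow\beta$ abbreviates $(\alpha\rightarrow\beta)\wedge(\beta\rightarrow\alpha)$. Its axiom schemes are: (A1) $\alpha\rightarrow(\beta\rightarrow\alpha)$; (A2) $(\alpha\rightarrow(\beta\rightarrow\gamma))\rightarrow((\alpha\rightarrow\beta)\rightarrow(\alpha\rightarrow\gamma))$; (A3) $\alpha\rightarrow(\alpha\vee\beta)$, $\beta\rightarrow(\alpha\vee\beta)$; (A4) $(\alpha\rightarrow\gamma)\rightarrow((\beta\rightarrow\gamma)\rightarrow((\alpha\vee\beta)\rightarrow\gamma))$; (A5) $(\alpha\wedge\beta)\rightarrow\alpha$, $(\alpha\wedge\beta)\rightarrow\beta$; (A6) $(\alpha\rightarrow\beta)\rightarrow((\alpha\rightarrow\gamma)\rightarrow(\alpha\rightarrow(\beta\wedge\gamma)))$;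 (A7) $\alpha\rightarrow\top$; (A8) $\bot\rightarrow\alpha$; (A9) $(\alpha\rightarrow\beta)\rightarrow((\alpha\rightarrow\neg\beta)\rightarrow\neg\alpha)$; (A10) $\neg\alpha\rightarrow(\alpha\rightarrow\beta)$; (A11) $\sim\alpha\leftrightarrow(\alpha\rightarrow\neg\neg\sim\top)$. Modus ponens is the only rule. Formulas of $\mathrm{ILM}_2$ are built from propositional variables and constants $\top,\bot$ with $\wedge,\vee,\rightarrow,\sim$. Its axiom schemes are (A1)–(A8), (A13) $(\alpha\rightarrow\beta)\rightarrow((\alpha\rightarrow\sim\beta)\rightarrow\sim\alpha)$, and (P$'$) $\sim\sim(\sim\top\rightarrow\beta)$. Modus ponens is the only rule. *)

(* Defs.v *)
Declare Scope ilm_scope.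
Delimit Scope ilm_scope with ilm.
Declare Scope ilm2_scope.
Delimit Scope ilm2_scope with ilm2.

Inductive ilm_form (V : Type) : Type :=
| ilm_var (x : V)
| ilm_top
| ilm_bot
| ilm_and (a b : ilm_form V)
| ilm_or  (a b : ilm_form V)
| ilm_imp (a b : ilm_form V)
| ilm_neg (a : ilm_form V)
| ilm_sim (a : ilm_form V).

Arguments ilm_var {V} x.
Arguments ilm_top {V}.
Arguments ilm_bot {V}.
Arguments ilm_and {V} a b.
Arguments ilm_or {V} a b.
Arguments ilm_imp {V} a b.
Arguments ilm_neg {V} a.
Arguments ilm_sim {V} a.
Bind Scope ilm_scope with ilm_form.

Definition ilm_iff {V : Type} (a b : ilm_form V) : ilm_form V :=
  ilm_and (ilm_imp a b) (ilm_imp b a).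

Notation "⊤" := ilm_top : ilm_scope.
Notation "⊥" := ilm_bot : ilm_scope.
Notation "¬ a" := (ilm_neg a) (at level 35, right associativity) : ilm_scope.
Notation "∼ a" := (ilm_sim a) (at level 35, right associativity) : ilm_scope.
Notation "a ∧ b" := (ilm_and a b) (at level 80, right associativity) : ilm_scope.
Notation "a ∨ b" := (ilm_or a b) (at level 85, right associativity) : ilm_scope.
Notation "a → b" := (ilm_imp a b) (at level 90, right associativity) : ilm_scope.
Notation "a ↔ b" := (ilm_iff a b) (at level 95, no associativity) : ilm_scope.

Inductive ilm2_form (V : Type) : Type :=
| ilm2_var (x : V)
| ilm2_top
| ilm2_bot
| ilm2_and (a b : ilm2_form V)
| ilm2_or  (a b : ilm2_form V)
| ilm2_imp (a b : ilm2_form V)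
| ilm2_sim (a : ilm2_form V).

Arguments ilm2_var {V} x.
Arguments ilm2_top {V}.
Arguments ilm2_bot {V}.
Arguments ilm2_and {V} a b.
Arguments ilm2_or {V} a b.
Arguments ilm2_imp {V} a b.
Arguments ilm2_sim {V} a.
Bind Scope ilm2_scope with ilm2_form.

Definition ilm2_neg {V : Type} (a : ilm2_form V) : ilm2_form V :=
  ilm2_imp a ilm2_bot.

Notation "⊤" := ilm2_top : ilm2_scope.
Notation "⊥" := ilm2_bot : ilm2_scope.
Notation "¬ a" := (ilm2_neg a) (at level 35, right associativity) : ilm2_scope.
Notation "∼ a" := (ilm2_sim a) (at level 35, right associativity) : ilm2_scope.
Notation "a ∧ b" := (ilm2_and a b) (at level 80, right associativity) : ilm2_scope.
Notation "a ∨ b" := (ilm2_or a b) (at level 85, right associativity) : ilm2_scope.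
Notation "a → b" := (ilm2_imp a b) (at level 90, right associativity) : ilm2_scope.

Inductive ilm_axiom {V : Type} : ilm_form V -> Prop :=
| ilm_A1 a b : ilm_axiom (a → (b → a))
| ilm_A2 a b c : ilm_axiom ((a → (b → c)) → ((a → b) → (a → c)))
| ilm_A3l a b : ilm_axiom (a → (a ∨ b))
| ilm_A3r a b : ilm_axiom (b → (a ∨ b))
| ilm_A4 a b c : ilm_axiom ((a → c) → ((b → c) → ((a ∨ b) → c)))
| ilm_A5l a b : ilm_axiom ((a ∧ b) → a)
| ilm_A5r a b : ilm_axiom ((a ∧ b) → b)
| ilm_A6 a b c : ilm_axiom ((a → b) → ((a → c) → (a → (b ∧ c))))
| ilm_A7 a : ilm_axiom (a → ⊤)
| ilm_A8 a : ilm_axiom (⊥ → a)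
| ilm_A9 a b : ilm_axiom ((a → b) → ((a → ¬ b) → ¬ a))
| ilm_A10 a b : ilm_axiom (¬ a → (a → b))
| ilm_A11 a : ilm_axiom (∼ a ↔ (a → ¬ ¬ ∼ ⊤)).

Inductive ilm_provable {V : Type} : ilm_form V -> Prop :=
| ilm_ax a : ilm_axiom a -> ilm_provable a
| ilm_mp a b : ilm_provable a -> ilm_provable (a → b) -> ilm_provable b.

Inductive ilm2_axiom {V : Type} : ilm2_form V -> Prop :=
| ilm2_A1 a b : ilm2_axiom (a → (b → a))
| ilm2_A2 a b c : ilm2_axiom ((a → (b → c)) → ((a → b) → (a → c)))
| ilm2_A3l a b : ilm2_axiom (a → (a ∨ b))
| ilm2_A3r a b : ilm2_axiom (b → (a ∨ b))
| ilm2_A4 a b c : ilm2_axiom ((a → c) → ((b → c) → ((a ∨ b) → c)))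
| ilm2_A5l a b : ilm2_axiom ((a ∧ b) → a)
| ilm2_A5r a b : ilm2_axiom ((a ∧ b) → b)
| ilm2_A6 a b c : ilm2_axiom ((a → b) → ((a → c) → (a → (b ∧ c))))
| ilm2_A7 a : ilm2_axiom (a → ⊤)
| ilm2_A8 a : ilm2_axiom (⊥ → a)
| ilm2_A13 a b : ilm2_axiom ((a → b) → ((a → ∼ b) → ∼ a))
| ilm2_P' b : ilm2_axiom (∼ ∼ (∼ ⊤ → b)).

Inductive ilm2_provable {V : Type} : ilm2_form V -> Prop :=
| ilm2_ax a : ilm2_axiom a -> ilm2_provable a
| ilm2_mp a b : ilm2_provable a -> ilm2_provable (a → b) -> ilm2_provable b.

Fixpoint ilm_star {V : Type} (a : ilm_form V) : ilm2_form V :=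
  match a with
  | ilm_var x => ilm2_var x
  | ilm_top => ⊤
  | ilm_bot => ⊥
  | ilm_and b c => ilm_star b ∧ ilm_star c
  | ilm_or b c => ilm_star b ∨ ilm_star c
  | ilm_imp b c => ilm_star b → ilm_star c
  | ilm_neg b => ¬ ilm_star b
  | ilm_sim b => ∼ ilm_star b
  end.

(* Main.v *)
(** In both logics [∼ a] is interderivable with [a → ∼ ⊤], and [∼ ⊤] is stable under double
    negation: in ILM₂ because [P'] at [⊥] reads [((∼ ⊤ → ⊥) → ∼ ⊤) → ∼ ⊤], in ILM because [A11]
    at [⊤] reads [∼ ⊤ ↔ (⊤ → ¬ ¬ ∼ ⊤)].  These two facts yield [A11] in ILM₂, and [A13] and [P']
    in ILM.  The converse direction of the equivalence then reads an ILM₂-proof of the translation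
    inside ILM, where [¬ b] and [b → ⊥] are interderivable and interderivability is a congruence. *)

Require Import Defs.
From Stdlib Require Import List.
Import ListNotations.

(** * Hilbert systems over an arbitrary implication, shared by both logics *)

Record hilbert {F : Type} (imp : F -> F -> F) (P : F -> Prop) : Prop := {
  hilbert_K a b : P (imp a (imp b a));
  hilbert_S a b c : P (imp (imp a (imp b c)) (imp (imp a b) (imp a c)));
  hilbert_mp a b : P a -> P (imp a b) -> P b }.

(* Hypotheses are discharged head first, so that the deduction theorem holds by conversion. *)
Definition entails {F : Type} (imp : F -> F -> F) (P : F -> Prop) (G : list F) (a : F) : Prop :=
  P (fold_left (fun c h => imp h c) G a).

Section Entailment.

Context {F : Type} {imp : F -> F -> F} {P : F -> Prop} (H : hilbert imp P).

Lemma entails_provable G a : P a -> entails imp P G a.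
Proof.
  revert a; induction G as [|h G IH]; intros a Pa; [exact Pa|].
  exact (IH _ (hilbert_mp _ _ H _ _ Pa (hilbert_K _ _ H a h))).
Qed.

Lemma entails_mp G a b :
  entails imp P G (imp a b) -> entails imp P G a -> entails imp P G b.
Proof.
  revert a b; induction G as [|h G IH]; intros a b Hab Ha.
  - exact (hilbert_mp _ _ H _ _ Ha Hab).
  - apply (IH (imp h a)); [|exact Ha].
    (* The scheme S distributes the discharged hypothesis [h] over [imp a b]. *)
    apply (IH (imp h (imp a b))); [|exact Hab].
    apply entails_provable, (hilbert_S _ _ H).
Qed.

Lemma entails_weaken h G a : entails imp P G a -> entails imp P (h :: G) a.
Proof.
  intros Ha; apply (entails_mp G a (imp h a)); [|exact Ha].
  apply entails_provable, (hilbert_K _ _ H).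
Qed.

Lemma entails_refl a G : entails imp P (a :: G) a.
Proof.
  apply (entails_provable G (imp a a)).
  apply (hilbert_mp _ _ H (imp a (imp a a))); [apply (hilbert_K _ _ H)|].
  apply (hilbert_mp _ _ H (imp a (imp (imp a a) a))); [apply (hilbert_K _ _ H)|].
  apply (hilbert_S _ _ H).
Qed.

Lemma entails_hyp G a : In a G -> entails imp P G a.
Proof.
  induction G as [|h G IH]; [intros []|].
  intros [->|Hin]; [apply entails_refl|now apply entails_weaken, IH].
Qed.

End Entailment.

Lemma ilm_hilbert (V : Type) : hilbert (@ilm_imp V) ilm_provable.
Proof.
  split; [intros; apply ilm_ax; constructor ..|exact ilm_mp].
Qed.

Lemma ilm2_hilbert (V : Type) : hilbert (@ilm2_imp V) ilm2_provable.
Proof.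
  split; [intros; apply ilm2_ax; constructor ..|exact ilm2_mp].
Qed.

Notation "G ⊢₁ a" := (entails ilm_imp ilm_provable G a%ilm) (at level 99, no associativity).
Notation "G ⊢₂ a" := (entails ilm2_imp ilm2_provable G a%ilm2) (at level 99, no associativity).

Ltac deduce :=
  lazymatch goal with
  | |- entails ?imp ?P ?G (?imp ?a ?b) => change (entails imp P (a :: G) b)
  end.

Ltac hyp1 := apply (entails_hyp (ilm_hilbert _)); simpl; tauto.
Ltac hyp2 := apply (entails_hyp (ilm2_hilbert _)); simpl; tauto.
Tactic Notation "mp1" uconstr(a) := apply (entails_mp (ilm_hilbert _) _ a).
Tactic Notation "mp2" uconstr(a) := apply (entails_mp (ilm2_hilbert _) _ a).
Ltac axiom1 := apply (entails_provable (ilm_hilbert _)), ilm_ax; constructor.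
Ltac axiom2 := apply (entails_provable (ilm2_hilbert _)), ilm2_ax; constructor.

(** * ILM₂ derives the translated axioms of ILM *)

Section ILM2.

Context {V : Type}.
Implicit Types (a b c : ilm2_form V) (G : list (ilm2_form V)).

Lemma ilm2_top_intro G : G ⊢₂ ⊤.
Proof.
  mp2 (⊥ → ⊥)%ilm2; [axiom2|deduce; hyp2].
Qed.

Lemma ilm2_bot_elim G a : (G ⊢₂ ⊥) -> G ⊢₂ a.
Proof.
  mp2 ⊥%ilm2; axiom2.
Qed.

Lemma ilm2_and_intro G a b : (G ⊢₂ a) -> (G ⊢₂ b) -> G ⊢₂ a ∧ b.
Proof.
  (* A6 needs a common antecedent for [a] and [b]; [⊤] serves. *)
  intros Ha Hb; mp2 ⊤%ilm2; [|apply ilm2_top_intro].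
  mp2 (⊤ → b)%ilm2; [mp2 (⊤ → a)%ilm2; [axiom2|]|];
    deduce; now apply (entails_weaken (ilm2_hilbert _)).
Qed.

(** A13 with [⊤] as its second formula; the first premise [a → ⊤] is A7. *)
Lemma ilm2_sim_intro G a : (a :: G ⊢₂ ∼ ⊤) -> G ⊢₂ ∼ a.
Proof.
  intros Ha; mp2 (a → ∼ ⊤)%ilm2; [|exact Ha].
  mp2 (a → ⊤)%ilm2; axiom2.
Qed.

(** A13 with [⊤] as its first formula: [⊤] implies both [a] and [∼ a]. *)
Lemma ilm2_sim_elim G a : (G ⊢₂ ∼ a) -> (G ⊢₂ a) -> G ⊢₂ ∼ ⊤.
Proof.
  intros Hna Ha; mp2 (⊤ → ∼ a)%ilm2; [mp2 (⊤ → a)%ilm2; [axiom2|]|];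
    deduce; now apply (entails_weaken (ilm2_hilbert _)).
Qed.

Lemma ilm2_sim_top_stable G : (G ⊢₂ ¬ ¬ ∼ ⊤) -> G ⊢₂ ∼ ⊤.
Proof.
  intros H; apply (ilm2_sim_elim G (∼ (∼ ⊤ → ⊥))); [axiom2|].
  (* The assumption [∼ ⊤ → ⊥] is [¬ ∼ ⊤] itself, which [H] refutes. *)
  apply ilm2_sim_intro, ilm2_bot_elim.
  mp2 (¬ ∼ ⊤)%ilm2; [|hyp2].
  now apply (entails_weaken (ilm2_hilbert _)).
Qed.

Lemma ilm_star_axiom (a : ilm_form V) : ilm_axiom a -> [] ⊢₂ ilm_star a.
Proof.
  destruct 1; simpl; try solve [axiom2]; unfold ilm2_neg.
  - do 3 deduce; mp2 (ilm_star b); [mp2 (ilm_star a)|mp2 (ilm_star a)]; hyp2.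
  - do 2 deduce; apply ilm2_bot_elim; mp2 (ilm_star a); hyp2.
  (* A11: forwards, [a] and [∼ a] give [∼ ⊤], against [¬ ∼ ⊤]; backwards, stability of [∼ ⊤] removes
     the double negation. *)
  - apply ilm2_and_intro; deduce.
    + do 2 deduce; mp2 (∼ ⊤)%ilm2; [hyp2|].
      apply (ilm2_sim_elim _ (ilm_star a)); hyp2.
    + apply ilm2_sim_intro, ilm2_sim_top_stable.
      mp2 (ilm_star a); hyp2.
Qed.

Lemma ilm_star_provable (a : ilm_form V) : ilm_provable a -> ilm2_provable (ilm_star a).
Proof.
  induction 1 as [a Ha|a b _ IHa _ IHab].
  - exact (ilm_star_axiom a Ha).
  - exact (ilm2_mp _ _ IHa IHab).
Qed.

End ILM2.

(** * Reading ILM₂-proofs inside ILM *)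

(** After [ilm_star], this rewrites every [¬ b] to [b → ⊥] within ILM. *)
Fixpoint ilm2_embed {V : Type} (a : ilm2_form V) : ilm_form V :=
  match a with
  | ilm2_var x => ilm_var x
  | ilm2_top => ⊤
  | ilm2_bot => ⊥
  | ilm2_and b c => ilm2_embed b ∧ ilm2_embed c
  | ilm2_or b c => ilm2_embed b ∨ ilm2_embed c
  | ilm2_imp b c => ilm2_embed b → ilm2_embed c
  | ilm2_sim b => ∼ ilm2_embed b
  end.

Section ILM.

Context {V : Type}.
Implicit Types (a b c : ilm_form V) (G : list (ilm_form V)).

Lemma ilm_top_intro G : G ⊢₁ ⊤.
Proof.
  mp1 (⊥ → ⊥)%ilm; [axiom1|deduce; hyp1].
Qed.

Lemma ilm_bot_elim G a : (G ⊢₁ ⊥) -> G ⊢₁ a.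
Proof.
  mp1 ⊥%ilm; axiom1.
Qed.

Lemma ilm_neg_intro G a : (a :: G ⊢₁ ⊥) -> G ⊢₁ ¬ a.
Proof.
  (* A9 with [⊥] as its second formula; [¬ ⊥] also follows from [⊥]. *)
  intros Ha; mp1 (a → ¬ ⊥)%ilm; [mp1 (a → ⊥)%ilm; [axiom1|exact Ha]|].
  deduce; now apply ilm_bot_elim.
Qed.

Lemma ilm_neg_elim G a b : (G ⊢₁ ¬ a) -> (G ⊢₁ a) -> G ⊢₁ b.
Proof.
  intros Hna Ha; mp1 a; [|exact Ha].
  mp1 (¬ a)%ilm; [axiom1|exact Hna].
Qed.

Lemma ilm_sim_unfold G a : (G ⊢₁ ∼ a) -> G ⊢₁ a → ¬ ¬ ∼ ⊤.
Proof.
  mp1 (∼ a)%ilm.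
  mp1 (∼ a ↔ (a → ¬ ¬ ∼ ⊤))%ilm; [|axiom1].
  unfold ilm_iff; axiom1.
Qed.

Lemma ilm_sim_fold G a : (G ⊢₁ a → ¬ ¬ ∼ ⊤) -> G ⊢₁ ∼ a.
Proof.
  mp1 (a → ¬ ¬ ∼ ⊤)%ilm.
  mp1 (∼ a ↔ (a → ¬ ¬ ∼ ⊤))%ilm; [|axiom1].
  unfold ilm_iff; axiom1.
Qed.

(** The right-to-left half of A11 at [⊤]. *)
Lemma ilm_sim_top_stable G : (G ⊢₁ ¬ ¬ ∼ ⊤) -> G ⊢₁ ∼ ⊤.
Proof.
  intros H; apply ilm_sim_fold; deduce.
  now apply (entails_weaken (ilm_hilbert _)).
Qed.

Lemma ilm_sim_intro G a : (a :: G ⊢₁ ∼ ⊤) -> G ⊢₁ ∼ a.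
Proof.
  intros H; apply ilm_sim_fold; deduce.
  apply ilm_neg_intro, (ilm_neg_elim _ (∼ ⊤)); [hyp1|].
  now apply (entails_weaken (ilm_hilbert _)).
Qed.

Lemma ilm_sim_elim G a : (G ⊢₁ ∼ a) -> (G ⊢₁ a) -> G ⊢₁ ∼ ⊤.
Proof.
  intros Hna Ha; apply ilm_sim_top_stable.
  mp1 a; [now apply ilm_sim_unfold|exact Ha].
Qed.

Lemma ilm2_embed_axiom (a : ilm2_form V) : ilm2_axiom a -> [] ⊢₁ ilm2_embed a.
Proof.
  destruct 1; simpl; try solve [axiom1].
  - do 2 deduce; apply ilm_sim_intro, (ilm_sim_elim _ (ilm2_embed b));
      mp1 (ilm2_embed a); hyp1.
  (* P′: assume [∼ (∼ ⊤ → b)] and, by stability, [¬ ∼ ⊤]. The latter gives [∼ ⊤ → b] by explosion,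
     hence [∼ ⊤], a contradiction. *)
  - apply ilm_sim_intro, ilm_sim_top_stable, ilm_neg_intro.
    apply (ilm_neg_elim _ (∼ ⊤)); [hyp1|].
    apply (ilm_sim_elim _ (∼ ⊤ → ilm2_embed b)); [hyp1|].
    deduce; apply (ilm_neg_elim _ (∼ ⊤)); hyp1.
Qed.

Lemma ilm2_embed_provable (a : ilm2_form V) : ilm2_provable a -> ilm_provable (ilm2_embed a).
Proof.
  induction 1 as [a Ha|a b _ IHa _ IHab].
  - exact (ilm2_embed_axiom a Ha).
  - exact (ilm_mp _ _ IHa IHab).
Qed.

(** * Interderivability in ILM is a congruence *)

Lemma ilm_cut G a b : ([] ⊢₁ a → b) -> (G ⊢₁ a) -> G ⊢₁ b.
Proof.
  intros Hab; mp1 a; exact (entails_provable (ilm_hilbert _) _ _ Hab).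
Qed.

Lemma ilm_and_mono a a' b b' :
  ([] ⊢₁ a → a') -> ([] ⊢₁ b → b') -> [] ⊢₁ (a ∧ b) → (a' ∧ b').
Proof.
  intros Ha Hb; mp1 ((a ∧ b) → b')%ilm; [mp1 ((a ∧ b) → a')%ilm; [axiom1|]|]; deduce.
  - apply (ilm_cut _ _ _ Ha); mp1 (a ∧ b)%ilm; [axiom1|hyp1].
  - apply (ilm_cut _ _ _ Hb); mp1 (a ∧ b)%ilm; [axiom1|hyp1].
Qed.

Lemma ilm_or_mono a a' b b' :
  ([] ⊢₁ a → a') -> ([] ⊢₁ b → b') -> [] ⊢₁ (a ∨ b) → (a' ∨ b').
Proof.
  intros Ha Hb; mp1 (b → (a' ∨ b'))%ilm; [mp1 (a → (a' ∨ b'))%ilm; [axiom1|]|]; deduce.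
  - mp1 a'; [axiom1|exact Ha].
  - mp1 b'; [axiom1|exact Hb].
Qed.

Lemma ilm_imp_mono a a' b b' :
  ([] ⊢₁ a' → a) -> ([] ⊢₁ b → b') -> [] ⊢₁ (a → b) → (a' → b').
Proof.
  intros Ha Hb; do 2 deduce.
  apply (ilm_cut _ _ _ Hb); mp1 a; [hyp1|].
  apply (ilm_cut _ _ _ Ha); hyp1.
Qed.

Lemma ilm_sim_anti a a' : ([] ⊢₁ a' → a) -> [] ⊢₁ ∼ a → ∼ a'.
Proof.
  intros Ha; deduce; apply ilm_sim_intro, (ilm_sim_elim _ a); [hyp1|].
  apply (ilm_cut _ _ _ Ha); hyp1.
Qed.

(** Both directions go through one induction because [→] on its left, [¬] and [∼] reverse
    implications. *)
Lemma ilm2_embed_star a :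
  ([] ⊢₁ a → ilm2_embed (ilm_star a)) /\ ([] ⊢₁ ilm2_embed (ilm_star a) → a).
Proof.
  induction a as [x| | |b [IHb IHb'] c [IHc IHc']|b [IHb IHb'] c [IHc IHc']
                 |b [IHb IHb'] c [IHc IHc']|b [IHb IHb']|b [IHb IHb']]; simpl.
  1-3: split; deduce; hyp1.
  - split; now apply ilm_and_mono.
  - split; now apply ilm_or_mono.
  - split; now apply ilm_imp_mono.
  (* Only here do the two formulas differ at the root: [¬ b] against an implication into [⊥]. *)
  - split; deduce; [deduce|apply ilm_neg_intro].
    + apply (ilm_neg_elim _ b); [hyp1|]; apply (ilm_cut _ _ _ IHb'); hyp1.
    + mp1 (ilm2_embed (ilm_star b)); [hyp1|]; apply (ilm_cut _ _ _ IHb); hyp1.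
  - split; now apply ilm_sim_anti.
Qed.

End ILM.

Theorem theorem3p13 (V : Type) (a : ilm_form V) :
  ilm_provable a <-> ilm2_provable (ilm_star a).
Proof.
  split; [apply ilm_star_provable|].
  intros H; apply (ilm_mp (ilm2_embed (ilm_star a))).
  - now apply ilm2_embed_provable.
  - apply ilm2_embed_star.
Qed.
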